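(* Let $S^w$ and $\hat S^w$ denote the weak Pareto solution sets of the piecewise linear problems (PLP) and $(\widehat{\mathrm{PLP}})$ described in the context, respectively. The following statements hold: (i) If $(\hat T(X_1)\oplus Z)\cap\mathrm{int}(C)=\emptyset$ then $\mathrm{WE}(f(A),C)=f(A)$ and $S^w=A$. (ii) If $(\hat T(X_1)\oplus Z)\cap\mathrm{int}(C)\neq\emptyset$ then $$\mathrm{WE}(f(A),C)=\hat T(X_1)+\mathrm{WE}(\hat f(\hat A),C_Z)\quad\text{and}\quad S^w=X_1+\hat S^w.$$
   Context: Notation. $\overline{1m}:=\{1,\dots,m\}$; $\mathcal{L}(X,Y)$ is the space of continuous linear operators; for $x^*\in X^*$, $\mathcal{N}(x^* )$ is its null space. A polyhedron in a normed space is the solution set of finitely many inequalities $\langle u^*,x\rangle\le s$ with $u^*$ in the dual space, $s\in\mathbb{R}$. $\mathcal{PL}(X,Y)$ is the set of $f:X\to Y$ such that $X$ is a finite union of polyhedra $P_i$ with $f=T_i+b_i$ on $P_i$ for some $T_i\in\mathcal{L}(X,Y)$, $b_i\in Y$. Efficiency. For a convex cone $K$ in a normed space $W$ with $\mathrm{int}(K)\neq\emptyset$ and $\Omega\subset W$, $\mathrm{WE}(\Omega,K)$ is the set of $\omega\in\Omega$ for which there is no $v\in\Omega$ with $\omega-v\in\mathrm{int}(K)$. Setting. $X,Y$ are normed spaces, $C\subset Y$ is a closed convex cone with $\mathrm{int}(C)\neq\emptyset$, $f\in\mathcal{PL}(X,Y)$, $\varphi_1,\dots,\varphi_l\in\mathcal{PL}(X,\mathbb{R})$.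 Problem (PLP) is: $C$-Min $f(x)$ subject to $\varphi_j(x)\le0$, $j\in\overline{1l}$; its feasible set is $A:=\{x\in X:\varphi_j(x)\le0\ \forall j\in\overline{1l}\}$, and its weak Pareto solutions are the $x\in A$ with $f(x)\in\mathrm{WE}(f(A),C)$. Fixed data: $T_i\in\mathcal{L}(X,Y)$, $u_{ik}^*,x_{ij}^*\in X^*$, $b_i\in Y$, $t_{ik},c_{ij}\in\mathbb{R}$ ($i\in\overline{1m}$, $k\in\overline{1q_i}$, $j\in\overline{1l}$) with $P_i=\{x\in X:\langle u_{ik}^*,x\rangle\le t_{ik}\ \forall k\in\overline{1q_i}\}$, $X=\bigcup_{i=1}^mP_i$, $\mathrm{int}(P_i)\neq\emptyset$, $P_i\cap\mathrm{int}(P_{i'})=\emptyset$ for $i\neq i'$, and $f=T_i+b_i$, $\varphi_j=x_{ij}^*-c_{ij}$ on $P_i$ for all $i,j$. Reduction. $X_1:=\bigcap_{i\in\overline{1m}}\bigcap_{(j,k)\in\overline{1l}\times\overline{1q_i}}\mathcal{N}(x_{ij}^* )\cap\mathcal{N}(u_{ik}^* )$. Let $\{e_1^*,\dots,e_\nu^*\}$ be a maximal linearly independent subset of $\{u_{ik}^*,x_{ij}^*\}$ (over all $i,j,k$), for each $\iota\in\overline{1\nu}$ choose $h_\iota\in X$ with $\langle e_\iota^*,h_\iota\rangle=1$ and $\langle e_{\iota'}^*,h_\iota\rangle=0$ for $\iota'\neq\iota$, and put $X_2:=\mathrm{span}\{h_1,\dots,h_\nu\}$; then $X=X_1\oplus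 X_2$. The restrictions of $T_1,\dots,T_m$ to $X_1$ coincide; $\hat T:=T_1|_{X_1}=\cdots=T_m|_{X_1}$. Let $D:=\bigcup_{i=1}^m\{T_i(h_1),\dots,T_i(h_\nu),b_i\}$ and choose $u_1,\dots,u_\varsigma\in D$ with $\varsigma$ maximal such that $u_1\in D\setminus\hat T(X_1)$, $u_2\in D\setminus(\hat T(X_1)+\mathrm{span}\{u_1\})$, ..., $u_\varsigma\in D\setminus(\hat T(X_1)+\mathrm{span}\{u_1,\dots,u_{\varsigma-1}\})$; put $Z:=\mathrm{span}\{u_1,\dots,u_\varsigma\}$, so $\hat T(X_1)\cap Z=\{0\}$. $\Pi_Z:\hat T(X_1)\oplus Z\to Z$ is the projection $\Pi_Z(y+z):=z$ for $(y,z)\in\hat T(X_1)\times Z$. $C_Z:=\Pi_Z((\hat T(X_1)\oplus Z)\cap C)$, a convex cone in $Z$. One has $f(X)\subset\hat T(X_1)\oplus Z$; define $\hat f:X_2\to Z$, $\hat f(x_2):=\Pi_Z(f(x_2))$. Problem $(\widehat{\mathrm{PLP}})$ is: $C_Z$-min $\hat f(x_2)$ subject to $x_2\in X_2$, $\varphi_1(x_2)\le0,\dots,\varphi_l(x_2)\le0$; its feasible set is $\hat A:=\{x_2\in X_2:\varphi_j(x_2)\le0\ \forall j\in\overline{1l}\}$, and, when $\mathrm{int}_Z(C_Z)\neq\emptyset$ (interior relative to $Z$; this holds in case (ii)), its weak Pareto solutions are the $x_2\in\hat A$ with $\hat f(x_2)\in\mathrm{WE}(\hat f(\hat A),C_Z)$.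 *)

(* Defs.v *)
From mathcomp Require Import all_boot all_order all_algebra.
From mathcomp Require Import all_classical all_reals all_analysis.
Set Implicit Arguments.
Unset Strict Implicit.
Unset Printing Implicit Defensive.
Import Order.TTheory GRing.Theory Num.Theory.
Import numFieldNormedType.Exports.
Local Open Scope classical_set_scope.
Local Open Scope ring_scope.

Section LinearAlgebra.
Context {R : realType} {V : lmodType R}.

Definition set_sum (A B : set V) : set V := [set a + b | a in A & b in B].

Definition lin_span (A : set V) : set V :=
  [set v | exists n (w : 'I_n -> V) (c : 'I_n -> R),
     (forall i, A (w i)) /\ v = \sum_i c i *: w i].

Definition lin_indep n (v : 'I_n -> V) : Prop :=
  forall c : 'I_n -> R, \sum_i c i *: v i = 0 -> forall i, c i = 0.

(* The finite linearly independent subsets of F are the ranges of linearly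
   independent families, whose members are automatically distinct. *)
Definition maximal_lin_indep (F : set V) n (e : 'I_n -> V) : Prop :=
  [/\ range e `<=` F, lin_indep e &
      forall k (g : 'I_k -> V), range g `<=` F -> lin_indep g ->
        range e `<=` range g -> range g = range e].

Definition extension_chain (D W : set V) n (u : 'I_n -> V) : Prop :=
  forall s : 'I_n,
    (D `\` set_sum W (lin_span [set u r | r in [set r : 'I_n | (r < s)%N]]))
      (u s).

Definition maximal_extension_chain (D W : set V) n (u : 'I_n -> V) : Prop :=
  extension_chain D W u /\
  forall k (v : 'I_k -> V), extension_chain D W v -> (k <= n)%N.

(* The z-component of y = w + z with w in W and z in Z, unique when W and Z
   meet only at 0; the value outside set_sum W Z is irrelevant. *)
Definition proj_along (W Z : set V) (y : V) : V :=
  xget 0 [set z | Z z /\ exists2 w, W w & y = w + z].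

Definition convex_cone (C : set V) : Prop :=
  @convex_set R V C /\ forall t x, 0 <= t -> C x -> C (t *: x).

End LinearAlgebra.

Section PiecewiseLinear.
Context {R : realType} {X Y : normedModType R}.

(* Elements of the dual of X are continuous maps {linear X -> R^o}. *)
Definition polyhedron (P : set X) : Prop :=
  exists n (u : 'I_n -> {linear X -> R^o}) (t : 'I_n -> R),
    (forall k, continuous (u k)) /\ P = [set x | forall k, u k x <= t k].

Definition piecewise_linear (f : X -> Y) : Prop :=
  exists n (P : 'I_n -> set X) (T : 'I_n -> {linear X -> Y}) (b : 'I_n -> Y),
    [/\ forall i, polyhedron (P i), forall i, continuous (T i),
        \bigcup_i P i = [set: X] & forall i x, P i x -> f x = T i x + b i].

End PiecewiseLinear.

Section Efficiency.
Context {R : realType} {W : normedModType R}.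

Definition WE (Omega K : set W) : set W :=
  [set w | Omega w /\ ~ exists2 v, Omega v & K° (w - v)].

(* The topology of [subspace Z] makes points outside Z isolated, so for a
   subset K of Z its interior is the interior of K relative to Z. *)
Definition rel_interior (Z K : set W) : set W :=
  @interior (subspace Z) K.

Definition WE_in (Z Omega K : set W) : set W :=
  [set w | Omega w /\ ~ exists2 v, Omega v & rel_interior Z K (w - v)].

End Efficiency.

Section Problem.
Context {R : realType} {X Y : normedModType R}.

Definition feasible l (B : set X) (phi : 'I_l -> X -> R) : set X :=
  [set x | B x /\ forall j, phi j x <= 0].

Definition weak_pareto (A : set X) (f : X -> Y) (C : set Y) : set X :=
  [set x | A x /\ WE (f @` A) C (f x)].

Definition weak_pareto_in (Z : set Y) (A : set X) (f : X -> Y) (C : set Y)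
    : set X :=
  [set x | A x /\ WE_in Z (f @` A) C (f x)].

Variables (m l : nat) (q : 'I_m -> nat).
Variables (u : forall i, 'I_(q i) -> {linear X -> R^o}).
Variables (xs : 'I_m -> 'I_l -> {linear X -> R^o}).

Definition piece (t : forall i, 'I_(q i) -> R) (i : 'I_m) : set X :=
  [set x | forall k, u k x <= t i k].

Definition all_functionals : set (X -> R^o) :=
  [set g | (exists i (k : 'I_(q i)), g = (u k : X -> R^o)) \/
           exists i j, g = (xs i j : X -> R^o)].

(* Stated so that it is also the intended subspace when l or some q i is 0. *)
Definition common_kernel : set X :=
  [set x | forall i,
     (forall j, xs i j x = 0) /\ forall k : 'I_(q i), u k x = 0].

Definition image_data (T : 'I_m -> {linear X -> Y}) (b : 'I_m -> Y) nu
    (h : 'I_nu -> X) : set Y :=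
  \bigcup_i (range (fun iota => T i (h iota)) `|` [set b i]).

End Problem.

(* Main.v *)
(* Moving x by v in X1 stays inside each piece, so it leaves every phi j
   unchanged and adds T ord0 v to f x; here all T i agree on X1 because they
   agree on pieces that meet and X is connected. Hence A = X1 + Ahat, and x in A
   is dominated iff f x - f x' - T ord0 v lies in the interior of C for some x'
   in Ahat and v in X1, that is, iff the coset of fhat x - fhat x' modulo
   T ord0 (X1) meets this interior. When T ord0 (X1) + Z meets the interior of
   C, the elements of Z whose coset does so form the relative interior of CZ;
   when it does not, no difference of values of f lies in the interior. *)
Require Import Defs.
From mathcomp Require Import all_boot all_order all_algebra.
From mathcomp Require Import all_classical all_reals all_analysis.
From mathcomp Require Import lra.
Set Implicit Arguments.
Unset Strict Implicit.
Unset Printing Implicit Defensive.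
Import Order.TTheory GRing.Theory Num.Theory.
Import numFieldNormedType.Exports.
Local Open Scope classical_set_scope.
Local Open Scope ring_scope.

(** * Linear subsets, spans, independent families and extension chains *)

Lemma lift_ord_max n (i : 'I_n) : lift ord_max i = widen_ord (leqnSn n) i.
Proof. by apply: val_inj; rewrite /= /bump leqNgt ltn_ord. Qed.

Section LinearSubsets.
Context {R : realType} {V : lmodType R}.
Implicit Types (A W Z D F : set V).

Definition linear_subset A : Prop :=
  A 0 /\ forall (a : R) x y, A x -> A y -> A (a *: x + y).

Lemma linear_subsetD A x y : linear_subset A -> A x -> A y -> A (x + y).
Proof. by case=> _ linA Ax Ay; rewrite -[x]scale1r; apply: linA. Qed.

Lemma linear_subsetZ A (a : R) x : linear_subset A -> A x -> A (a *: x).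
Proof. by case=> A0 linA Ax; rewrite -[_ *: _]addr0; apply: linA. Qed.

Lemma linear_subsetB A x y : linear_subset A -> A x -> A y -> A (x - y).
Proof.
move=> linA Ax Ay; apply: linear_subsetD => //.
by rewrite -scaleN1r; apply: linear_subsetZ.
Qed.

Lemma linear_subset_sum A (I : Type) (r : seq I) (v : I -> V) :
  linear_subset A -> (forall i, A (v i)) -> A (\sum_(i <- r) v i).
Proof.
move=> linA Av; apply: big_ind => //; first by case: linA.
by move=> x y; apply: linear_subsetD.
Qed.

Lemma linear_subset_set_sum A B :
  linear_subset A -> linear_subset B -> linear_subset (set_sum A B).
Proof.
move=> linA linB; split.
  exists 0; first by case: linA.
  by exists 0; [case: linB | rewrite addr0].
move=> a _ _ [x1 Ax1] [y1 By1 <-] [x2 Ax2] [y2 By2 <-].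
exists (a *: x1 + x2); first by case: linA => _; apply.
exists (a *: y1 + y2); first by case: linB => _; apply.
by rewrite scalerDr addrACA.
Qed.

(** Collecting equal vectors turns an arbitrary combination into one indexed by the whole family.
    The set [S] is kept because extension chains use spans of initial segments. *)
Lemma lin_span_imageP n (v : 'I_n -> V) (S : set 'I_n) (x : V) :
  lin_span (v @` S) x <->
  exists2 c : 'I_n -> R, (forall i, ~ S i -> c i = 0) & x = \sum_i c i *: v i.
Proof.
split=> [[k [x' [c [vx' ->]]]] | [c c0 ->]].
  have /choice[g gP] : forall j, exists i, S i /\ v i = x' j.
    by move=> j; have [i Si <-] := vx' j; exists i.
  (* The coefficient of [v i] is the sum over the fibre of the choice function [g] at [i]. *)
  exists (fun i => \sum_(j | g j == i) c j).
    move=> i nSi; apply: big_pred0 => j; apply/negbTE/eqP => gji.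
    by apply: nSi; rewrite -gji; have [] := gP j.
  rewrite (partition_big g xpredT)//=; apply: eq_bigr => i _.
  rewrite scaler_suml; apply: eq_bigr => j /eqP <-.
  by have [_ ->] := gP j.
(* Every listed vector must come from [S], so indices outside [S] receive [v i0] with coefficient 0;
   if [S] is empty, the empty combination serves. *)
have [[i0 Si0]|S0] := pselect (exists i, S i); last first.
  exists 0%N, (fun=> 0), (fun=> 0); split; first by case.
  rewrite big_ord0 big1// => i _; rewrite c0 ?scale0r//.
  by move=> Si; apply: S0; exists i.
exists n, (fun i => if `[< S i >] then v i else v i0), c; split.
  by move=> i; case: asboolP => Si; [exists i | exists i0].
by apply: eq_bigr => i _; case: asboolP => // /c0 ->; rewrite !scale0r.
Qed.

Lemma lin_span_rangeP n (v : 'I_n -> V) (x : V) :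
  lin_span (range v) x <-> exists c : 'I_n -> R, x = \sum_i c i *: v i.
Proof.
rewrite lin_span_imageP; split=> [[c _ ->]|[c ->]]; first by exists c.
by exists c => // i /(_ I).
Qed.

Lemma linear_subset_span n (v : 'I_n -> V) : linear_subset (lin_span (range v)).
Proof.
split.
  apply/lin_span_rangeP; exists (fun=> 0).
  by rewrite big1// => i; rewrite scale0r.
move=> a x y /lin_span_rangeP[c ->] /lin_span_rangeP[d ->].
apply/lin_span_rangeP; exists (fun i => a * c i + d i).
rewrite scaler_sumr -big_split/=; apply: eq_bigr => i _.
by rewrite scalerDl scalerA.
Qed.

(** [unlift ord_max] is [None] exactly at the last index, where [x] is placed. *)
Definition family_rcons n (v : 'I_n -> V) (x : V) (i : 'I_n.+1) : V :=
  oapp v x (unlift ord_max i).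

Lemma family_rcons_max n (v : 'I_n -> V) x : family_rcons v x ord_max = x.
Proof. by rewrite /family_rcons unlift_none. Qed.

Lemma family_rcons_widen n (v : 'I_n -> V) x i :
  family_rcons v x (widen_ord (leqnSn n) i) = v i.
Proof.
by rewrite /family_rcons -lift_ord_max liftK.
Qed.

Lemma family_rcons_ind n (v : 'I_n -> V) x (P : V -> Prop) :
  P x -> (forall i, P (v i)) -> forall i, P (family_rcons v x i).
Proof.
by move=> Px Pv i; rewrite /family_rcons; case: unliftP => [j _|_]//=.
Qed.

(** A vanishing combination with nonzero last coefficient could be solved for [x]. *)
Lemma lin_indep_rcons n (v : 'I_n -> V) x :
  lin_indep v -> ~ lin_span (range v) x -> lin_indep (family_rcons v x).
Proof.
move=> indv nx c; rewrite big_ord_recr/= family_rcons_max.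
under eq_bigr do rewrite family_rcons_widen.
move=> c0; have cmax : c ord_max = 0.
  apply: contrapT => /eqP cn0; apply: nx; apply/lin_span_rangeP.
  exists (fun i => - (c ord_max)^-1 * c (widen_ord (leqnSn n) i)).
  under eq_bigr do rewrite -scalerA.
  rewrite -scaler_sumr (_ : \sum_i _ = - (c ord_max *: x)); last first.
    by apply/eqP; rewrite -addr_eq0 c0.
  by rewrite scaleNr scalerN opprK scalerA mulVf// scale1r.
move: c0; rewrite cmax scale0r addr0 => /indv c0 i.
have [j ->|->//] := unliftP ord_max i.
by rewrite lift_ord_max c0.
Qed.

(** A [g] outside the span could be appended, giving a larger independent family in [F]; maximality
    then forces [g] back into [range e]. *)
Lemma maximal_lin_indep_span F n (e : 'I_n -> V) :
  maximal_lin_indep F e -> F `<=` lin_span (range e).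
Proof.
case=> eF inde maxe g Fg; apply: contrapT => ng.
have eg : range e `<=` range (family_rcons e g).
  move=> _ [i _ <-]; exists (widen_ord (leqnSn n) i) => //.
  by rewrite family_rcons_widen.
have sub : range (family_rcons e g) `<=` F.
  by move=> _ [i _ <-]; apply: family_rcons_ind => // j; apply: eF; exists j.
have geq := maxe _ _ sub (lin_indep_rcons inde ng) eg.
have /=[i _ eig] : range e g.
  by rewrite -geq; exists ord_max; rewrite // family_rcons_max.
apply: ng; apply/lin_span_rangeP; exists (fun j => (j == i)%:R).
rewrite (bigD1 i)//= eqxx scale1r eig big1 ?addr0// => j /negbTE ->.
by rewrite scale0r.
Qed.

(* If a nontrivial combination of the w r lies in W, solving for its last
   vector contradicts the choice of that vector. *)
Lemma extension_chain_cap0 D W n (w : 'I_n -> V) y :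
  linear_subset W -> extension_chain D W w ->
  W y -> lin_span (range w) y -> y = 0.
Proof.
move=> linW chw Wy /lin_span_rangeP[c yE].
have [c0|] := pselect (forall i, c i = 0).
  by rewrite yE big1// => i _; rewrite c0 scale0r.
move=> /existsNP[i0 /eqP ci0]; exfalso.
(* [i] is the largest index with a nonzero coefficient, so only earlier vectors remain when solving
   for [w i]. *)
have [i {i0 ci0} ci0 imax] :
    exists2 i, c i != 0 & forall j, c j != 0 -> (j <= i)%N.
  have := @arg_maxnP _ i0 (fun j => c j != 0) (@nat_of_ord n) ci0.
  by case=> i; exists i.
have [_] := chw i; apply.
have wi : w i = (c i)^-1 *: y +
    \sum_(j < n) (if (j < i)%N then - (c i)^-1 * c j else 0) *: w j.
  have -> : y = c i *: w i + \sum_(j < n) (if (j < i)%N then c j else 0) *: w j.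
    rewrite yE (bigD1 i)//=; congr (_ + _).
    rewrite [RHS](bigD1 i)//= ltnn scale0r add0r; apply: eq_bigr => j ji.
    case: ltnP => // ij; suff -> : c j = 0 by [].
    apply/eqP/negPn/negP => /imax ji'; move: ji; apply/negP/negPn.
    by rewrite -val_eqE/= eqn_leq ji' ij.
  rewrite scalerDr scalerA mulVf// scale1r -addrA scaler_sumr -big_split/=.
  rewrite big1 ?addr0// => j _; rewrite scalerA -scalerDl.
  by case: ifP => _; rewrite ?mulr0 ?addr0 ?mulNr ?addrN scale0r.
rewrite wi; exists ((c i)^-1 *: y); first exact: linear_subsetZ.
eexists; last by [].
apply/lin_span_imageP; eexists; last by [].
by move=> j /=/negP/negbTE ->.
Qed.

(** A [d] in [D] outside the sum would prolong the chain to length [n.+1]. *)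
Lemma maximal_extension_chain_sub D W n (w : 'I_n -> V) :
  maximal_extension_chain D W w -> D `<=` set_sum W (lin_span (range w)).
Proof.
case=> chw maxw d Dd; apply: contrapT => nd.
suff /maxw : extension_chain D W (family_rcons w d) by rewrite ltnn.
have sum_rcons (c : 'I_n.+1 -> R) : c ord_max = 0 ->
    \sum_i c i *: family_rcons w d i =
    \sum_i c (widen_ord (leqnSn n) i) *: w i.
  move=> c0; rewrite big_ord_recr/= c0 scale0r addr0.
  by apply: eq_bigr => i _; rewrite family_rcons_widen.
(* At the last index the earlier vectors are all of [w]; at an old index the condition is that of
   [w], since the coefficient of [d] is 0. *)
move=> i; have [j ij|->] := unliftP ord_max i; last first.
  rewrite family_rcons_max; split => // -[y Wy [z zs yz]]; apply: nd.
  exists y => //; exists z => //; move: zs => /lin_span_imageP[c c0 ->].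
  apply/lin_span_rangeP; exists (fun i => c (widen_ord (leqnSn n) i)).
  by apply: sum_rcons; apply: c0 => /=; rewrite ltnn.
rewrite ij lift_ord_max family_rcons_widen; split; first by have [] := chw j.
case=> y Wy [z zs yz]; have [_] := chw j; apply.
exists y => //; exists z => //; move: zs => /lin_span_imageP[c c0 ->].
apply/lin_span_imageP; exists (fun i => c (widen_ord (leqnSn n) i)).
  by move=> k kj; apply: c0.
apply: sum_rcons; apply: c0 => /= nj.
by have := ltn_trans nj (ltn_ord j); rewrite ltnn.
Qed.

(** Two candidates [z] and [z'] differ by an element of both [Z] and [W], hence by 0. *)
Lemma proj_alongE W Z w z : linear_subset W -> linear_subset Z ->
  (forall y, W y -> Z y -> y = 0) -> W w -> Z z -> proj_along W Z (w + z) = z.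
Proof.
move=> linW linZ WZ0 Ww Zz; rewrite /proj_along; apply: xget_unique.
  by split => //; exists w.
move=> z' [Zz' [w' Ww' wz]]; apply/eqP; rewrite -subr_eq0; apply/eqP.
apply: WZ0; last exact: linear_subsetB.
suff -> : z' - z = w - w' by exact: linear_subsetB.
by apply/eqP; rewrite subr_eq addrAC eq_sym subr_eq wz addrC.
Qed.

End LinearSubsets.

Lemma linear_subset_image_linear (R : realType) (V W : lmodType R)
    (T : {linear V -> W}) (A : set V) :
  linear_subset A -> linear_subset (T @` A).
Proof.
case=> A0 linA; split; first by exists 0; rewrite ?linear0.
move=> a _ _ [x Ax <-] [y Ay <-].
by exists (a *: x + y); rewrite ?linearP//; apply: linA.
Qed.

(** * Interiors of convex cones and of their projections *)

Section ConeInterior.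
Context {R : realType} {Y : normedModType R}.
Implicit Types (W Z C : set Y).

(** The sum is twice the midpoint, which convexity puts in [C]. *)
Lemma convex_coneD C x y : convex_cone C -> C x -> C y -> C (x + y).
Proof.
case=> convC coneC Cx Cy.
have half0 : 0 <= (2^-1 : R) by lra.
have half1 : (2^-1 : R) <= 1 by lra.
have /set_mem mid := convC x y (Itv01 half0 half1) (mem_set Cx) (mem_set Cy).
have := coneC 2 _ ltac:(lra) mid.
rewrite /conv/= /unstable.onem scalerDr !scalerA.
by have -> : 2 * (1 - 2^-1) = 1 :> R; [lra|rewrite mulfV// !scale1r].
Qed.

Lemma convex_cone_interiorD C x y :
  convex_cone C -> C x -> C° y -> C° (x + y).
Proof.
move=> coneC Cx Cy; rewrite /interior/=.
have cvgy : (z - x) @[z --> x + y] --> y.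
  rewrite [X in _ --> X](_ : y = x + y - x); last by rewrite addrAC subrr add0r.
  by apply: cvgB; [exact: cvg_id | exact: cvg_cst].
have : \forall z \near x + y, C (z - x) by exact: cvgy.
apply: filterS => z Czx.
by rewrite -(subrK x z); apply: convex_coneD.
Qed.

Lemma convex_cone_interiorZ C (a : R) y :
  convex_cone C -> 0 < a -> C° y -> C° (a *: y).
Proof.
move=> [_ coneC] a0 Cy; rewrite /interior/=.
have cvgy : a^-1 *: z @[z --> a *: y] --> y.
  rewrite -[X in _ --> X]scale1r -(mulVf (lt0r_neq0 a0)) -scalerA.
  exact: scaler_continuous.
have : \forall z \near a *: y, C (a^-1 *: z) by exact: cvgy.
apply: filterS => z /(coneC _ _ (ltW a0)).
by rewrite scalerA mulfV ?lt0r_neq0// scale1r.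
Qed.

Lemma rel_interiorP Z C z : Z z ->
  rel_interior Z C z <-> \forall x \near z, Z x -> C x.
Proof.
move=> Zz; rewrite /rel_interior /interior/=.
by have -> : nbhs (z : subspace Z) = within Z (nbhs z);
  [rewrite nbhs_subspace_in|].
Qed.

Lemma rel_interior_sub Z C : rel_interior Z C `<=` C.
Proof. by move=> z; apply: nbhs_subspace_singleton. Qed.

(* W need not be closed, so proj_along W Z need not be continuous. It is open,
   however; conversely, a point of the relative interior stays in the projected
   cone when a small multiple of the projection of an interior point of C is
   subtracted from it. *)
Lemma rel_interior_proj_along W Z C z :
  linear_subset W -> linear_subset Z -> (forall y, W y -> Z y -> y = 0) ->
  convex_cone C -> set_sum W Z `&` C° !=set0 ->
  rel_interior Z (proj_along W Z @` (set_sum W Z `&` C)) z <->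
  Z z /\ exists2 y, W y & C° (y + z).
Proof.
move=> linW linZ WZ0 coneC [_ [[w1 Ww1 [z1 Zz1 <-]] C1]].
split.
  move=> Kz; have [_ [[w0 Ww0 [z0 Zz0 <-]] _] zE] := rel_interior_sub Kz.
  have Zz : Z z by rewrite -zE proj_alongE.
  split=> //; move: Kz => /(rel_interiorP _ Zz) Kz.
  have cvgz : (z - a *: z1) @[a --> (0 : R)^'+] --> z.
    rewrite -[X in _ --> X]subr0; apply: cvgB; first exact: cvg_cst.
    rewrite -(scale0r z1); apply: cvg_at_right_filter.
    exact: scalel_continuous.
  have /= [a [a0 Ka]] : exists a : R, 0 < a /\
      (proj_along W Z @` (set_sum W Z `&` C)) (z - a *: z1).
    have Kz' : \forall a \near (0 : R)^'+, Z (z - a *: z1) ->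
        (proj_along W Z @` (set_sum W Z `&` C)) (z - a *: z1).
      exact: (cvgz _ Kz).
    near (0 : R)^'+ => a; exists a; split.
      by near: a; exact: nbhs_right_gt.
    have Za : Z (z - a *: z1).
      by apply: linear_subsetB => //; apply: linear_subsetZ.
    by apply: (near Kz' a).
  move: Ka => [_ [[w2 Ww2 [z2 Zz2 <-]] C2]]; rewrite proj_alongE// => z2E.
  (* Since [z = z2 + a *: z1], adding [z] to this witness gives a point of [C] plus a positive
     multiple of the interior point [w1 + z1]. *)
  exists (w2 + a *: w1).
    by apply: linear_subsetD => //; apply: linear_subsetZ.
  rewrite (_ : _ + z = (w2 + z2) + a *: (w1 + z1)).
    by apply: convex_cone_interiorD => //; apply: convex_cone_interiorZ.
  by rewrite z2E scalerDr addrACA subrK.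
case=> Zz [y Wy Cyz]; apply/rel_interiorP => //.
(* With [y] in [W] fixed, every [x] in [Z] near [z] is the projection of [y + x], which is still in
   [C]. *)
have cvgy : y + x @[x --> z] --> y + z by apply: cvgD => //; exact: cvg_cst.
have : \forall x \near z, C (y + x) by exact: cvgy.
apply: filterS => x Cx Zx.
exists (y + x); last by rewrite proj_alongE.
by split => //; exists y => //; exists x.
Unshelve. all: by end_near. Qed.

End ConeInterior.

(** * Connectedness and finite closed covers *)

Lemma connected_finite_closed_cover (X : topologicalType) (I : finType)
    (A : Type) (P : I -> set X) (a : I -> A) :
  connected [set: X] -> (forall i, closed (P i)) -> \bigcup_i P i = [set: X] ->
  (forall i, P i !=set0) -> (forall i j, P i `&` P j !=set0 -> a i = a j) ->
  forall i j, a i = a j.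
Proof.
move=> conX clP covP P0 aP i j.
(* [S] unites the sets labelled like [P i]. Sets with different labels are disjoint, so the
   complement of [S] is also a finite union of closed sets; thus [S] is clopen. *)
pose S := \bigcup_(k in [set k | a k = a i]) P k.
have clS : closed S by apply: closed_bigcup => //; exact: finite_finset.
have SC : ~` S = \bigcup_(k in [set k | a k <> a i]) P k.
  apply/seteqP; split=> x.
    move=> nSx; have [k _ Pkx] : (\bigcup_i P i) x by rewrite covP.
    by exists k => // aki; apply: nSx; exists k.
  move=> [k aki Pkx] [k' ak'i Pk'x]; apply: aki; rewrite -ak'i.
  by apply: aP; exists x.
have opS : open S.
  rewrite -[S]setCK openC SC.
  by apply: closed_bigcup => //; exact: finite_finset.
have ST : S = setT.
  apply: conX; [|by exists S; rewrite ?setTI..].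
  by have [x Pix] := P0 i; exists x, i.
have [x Pjx] := P0 j.
have [k /= <- Pkx] : S x by rewrite ST.
by apply: aP; exists x.
Qed.

(** The space is a union of continuous images of the real line, all containing 0. *)
Lemma normedMod_connected (R : realType) (X : normedModType R) :
  connected [set: X].
Proof.
have -> : [set: X] = \bigcup_(x in [set: X]) range (fun a : R => a *: x).
  by apply/seteqP; split=> // x _; exists x => //; exists 1; rewrite // scale1r.
apply: bigcup_connected.
  by exists 0 => x _; exists 0; rewrite // scale0r.
move=> x _; apply: connected_continuous_connected.
  by apply/connected_intervalP.
apply: continuous_subspaceT => a; exact: scalel_continuous.
Qed.

(** * The pieces, their common kernel and the splitting of [X] *)

Section Pieces.
Context {R : realType} {X Y : normedModType R}.
Variables (m l : nat) (q : 'I_m -> nat).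
Variables (u : forall i, 'I_(q i) -> {linear X -> R^o}).
Variables (t : forall i, 'I_(q i) -> R).
Variables (xs : 'I_m -> 'I_l -> {linear X -> R^o}).

Local Notation X1 := (common_kernel u xs).

Lemma linear_subset_common_kernel : linear_subset X1.
Proof.
split; first by move=> i; split=> [j|k]; rewrite linear0.
move=> a x y Kx Ky i; have [xsx ux] := Kx i; have [xsy uy] := Ky i.
by split=> j; rewrite linearP ?xsx ?xsy ?ux ?uy scaler0 addr0.
Qed.

Lemma common_kernelN v : X1 v -> X1 (- v).
Proof.
by rewrite -scaleN1r; apply: linear_subsetZ; exact: linear_subset_common_kernel.
Qed.

Lemma piece_add_common_kernel i x v :
  X1 v -> piece u t i x -> piece u t i (x + v).
Proof. by move=> Kv Px k; rewrite linearD (Kv i).2 addr0; apply: Px. Qed.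

Lemma closed_piece i : (forall k, continuous (u (i := i) k)) ->
  closed (piece u t i).
Proof.
move=> uc; have -> : piece u t i =
    \bigcap_(k in [set: 'I_(q i)]) (u k @^-1` [set r : R | r <= t k]).
  by apply/seteqP; split=> [x Px k _|x Px k]; [exact: Px | exact: Px k I].
apply: closed_bigI => k _; apply: preimage_closed; last exact: closed_le.
by move=> x _; apply: uc.
Qed.

(* On piece i the increment f (x + v) - f x is T i v, so the values of T i v
   agree on meeting pieces, and X is connected. *)
Lemma linear_parts_agree (T : 'I_m -> {linear X -> Y}) (b : 'I_m -> Y)
    (f : X -> Y) :
  (forall i (k : 'I_(q i)), continuous (u k)) ->
  \bigcup_i piece u t i = [set: X] ->
  (forall i, piece u t i !=set0) ->
  (forall i x, piece u t i x -> f x = T i x + b i) ->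
  forall v, X1 v -> forall i j, T i v = T j v.
Proof.
move=> uc cover P0 fE v Kv.
have incr i x : piece u t i x -> T i v = f (x + v) - f x.
  move=> Px; rewrite (fE i _ Px) (fE i); last exact: piece_add_common_kernel.
  by rewrite linearD [_ + T i v + b i]addrAC [RHS]addrAC subrr add0r.
apply: (connected_finite_closed_cover (@normedMod_connected R X) _ cover P0).
  by move=> i; apply: closed_piece => k; apply: uc.
by move=> i j [x [Pix Pjx]]; rewrite (incr i x)// (incr j x).
Qed.

Lemma all_functionalsD g x y : all_functionals u xs g -> g (x + y) = g x + g y.
Proof. by move=> [[i [k ->]]|[i [j ->]]]; rewrite linearD. Qed.

Lemma all_functionalsZ g a x : all_functionals u xs g -> g (a *: x) = a * g x.
Proof. by move=> [[i [k ->]]|[i [j ->]]]; rewrite linearZ. Qed.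

(** By duality each [e i] vanishes on the difference, and by maximality the [e i] span all the
    functionals that define [X1]. *)
Lemma dual_decomposition nu (e : 'I_nu -> X -> R^o) (h : 'I_nu -> X) :
  maximal_lin_indep (all_functionals u xs) e ->
  (forall i i', e i (h i') = (i == i')%:R) ->
  forall x, X1 (x - \sum_i e i x *: h i).
Proof.
move=> emax eh x; set v := x - _.
have eF i : all_functionals u xs (e i) by have [+ _ _] := emax; apply; exists i.
have eD i := all_functionalsD _ _ (eF i).
have eZ i := all_functionalsZ _ _ (eF i).
(* [e i] is a bare function; its linearity is recovered from membership in [all_functionals]. *)
have esum (I : Type) (r : seq I) i (c : I -> R) (y : I -> X) :
    e i (\sum_(j <- r) c j *: y j) = \sum_(j <- r) c j * e i (y j).
  elim: r => [|j r IH]; last first.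
    by rewrite !big_cons eD eZ IH.
  by rewrite !big_nil -(scale0r 0) eZ mul0r.
have ev i : e i v = 0.
  rewrite /v eD -scaleN1r eZ.
  rewrite esum (bigD1 i)//= eh eqxx mulr1 big1.
    by rewrite addr0 mulN1r subrr.
  by move=> j /negbTE ji; rewrite eh eq_sym ji mulr0.
have gv g : all_functionals u xs g -> g v = 0.
  move=> /(maximal_lin_indep_span emax)/lin_span_rangeP[c ->].
  rewrite fct_sumE big1// => i _; have -> : (c i *: e i) v = c i * e i v by [].
  by rewrite ev mulr0.
move=> i; split=> [j|k]; apply: gv; first by right; exists i, j.
by left; exists i, k.
Qed.

End Pieces.

(** Here [c] and [d] serve as the [Z]-components of [x] and [y]: subtracting [r] from [x - y] turns
    its other component into [s] and keeps [c - d]. *)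
Lemma subr_components (V : zmodType) (x y c d r s : V) :
  r = (x - c) - (y - d) - s -> x - (y + r) = s + (c - d).
Proof.
move=> ->; rewrite -{1}(subrK c x) -{1}(subrK d y).
move: (x - c) (y - d) => a b.
rewrite [b + d + _]addrACA [b + _]addrC subrK opprD addrACA subrr add0r opprB.
exact: addrCA.
Qed.

(** * Transfer of weak efficiency between the problem and its reduction *)

Theorem theorem4p1 (R : realType) (X Y : normedModType R)
  (C : set Y) (f : X -> Y) (l : nat) (phi : 'I_l -> X -> R^o)
  (C_closed : closed C) (C_cone : convex_cone C) (C_int : C° !=set0)
  (f_pl : piecewise_linear f) (phi_pl : forall j, piecewise_linear (phi j))
  (* representation of f and phi; the number of pieces is m.+1 *)
  (m : nat) (q : 'I_m.+1 -> nat)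
  (T : 'I_m.+1 -> {linear X -> Y}) (b : 'I_m.+1 -> Y)
  (u : forall i, 'I_(q i) -> {linear X -> R^o}) (t : forall i, 'I_(q i) -> R)
  (xs : 'I_m.+1 -> 'I_l -> {linear X -> R^o}) (c : 'I_m.+1 -> 'I_l -> R)
  (T_cont : forall i, continuous (T i))
  (u_cont : forall i k, continuous (u i k))
  (xs_cont : forall i j, continuous (xs i j))
  (P_cover : \bigcup_i piece u t i = [set: X])
  (P_int : forall i, (piece u t i)° !=set0)
  (P_disj : forall i i', i != i' -> piece u t i `&` (piece u t i')° = set0)
  (f_eq : forall i x, piece u t i x -> f x = T i x + b i)
  (phi_eq : forall i j x, piece u t i x -> phi j x = xs i j x - c i j)
  (* reduction *)
  (nu : nat) (e : 'I_nu -> X -> R^o) (h : 'I_nu -> X)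
  (e_max : maximal_lin_indep (all_functionals u xs) e)
  (h_dual : forall i i', e i (h i') = (i == i')%:R)
  (s : nat) (w : 'I_s -> Y)
  (w_max : maximal_extension_chain (image_data T b h)
             (T ord0 @` common_kernel u xs) w) :
  let A := feasible setT phi in
  let X1 := common_kernel u xs in
  let X2 := lin_span (range h) in
  let TX1 := T ord0 @` X1 in
  let Z := lin_span (range w) in
  let PiZ := proj_along TX1 Z in
  let CZ := PiZ @` (set_sum TX1 Z `&` C) in
  let fhat := fun x => PiZ (f x) in
  let Ahat := feasible X2 phi in
  let Sw := weak_pareto A f C in
  let Swhat := weak_pareto_in Z Ahat fhat CZ in
  (set_sum TX1 Z `&` C° = set0 -> WE (f @` A) C = f @` A /\ Sw = A) /\
  (set_sum TX1 Z `&` C° !=set0 ->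
     WE (f @` A) C = set_sum TX1 (WE_in Z (fhat @` Ahat) CZ) /\
     Sw = set_sum X1 Swhat).
Proof.
move=> A X1 X2 TX1 Z PiZ CZ fhat Ahat Sw Swhat.
have linX1 : linear_subset X1 by exact: linear_subset_common_kernel.
have linTX1 : linear_subset TX1 by exact: linear_subset_image_linear.
have linZ : linear_subset Z by exact: linear_subset_span.
have linE := linear_subset_set_sum linTX1 linZ.
have cap0 y : TX1 y -> Z y -> y = 0.
  by apply: extension_chain_cap0; [exact: linTX1 | exact: w_max.1].
have piece_of x : exists i, piece u t i x.
  by have [i _ Px] : (\bigcup_i piece u t i) x by [rewrite P_cover]; exists i.
have T0E i v : X1 v -> T i v = T ord0 v.
  move=> Kv; apply: (linear_parts_agree u_cont P_cover _ f_eq Kv) => k.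
  by have [x /interior_subset] := P_int k; exists x.
have fD x v : X1 v -> f (x + v) = f x + T ord0 v.
  move=> Kv; have [i Px] := piece_of x.
  rewrite (f_eq _ _ Px) (f_eq i); last exact: piece_add_common_kernel Kv Px.
  by rewrite linearD (T0E i v Kv) addrAC.
have phiD j x v : X1 v -> phi j (x + v) = phi j x.
  move=> Kv; have [i Px] := piece_of x.
  rewrite (phi_eq _ _ _ Px) (phi_eq i); last exact: piece_add_common_kernel Kv Px.
  by rewrite linearD (Kv i).1 addr0.
have AD x v : X1 v -> A x -> A (x + v).
  by move=> Kv [_ Ax]; split=> // j; rewrite phiD.
have AhatA : Ahat `<=` A by move=> x [_ Ax].
have split_X x : exists x2 v, [/\ X2 x2, X1 v & x = x2 + v].
  exists (\sum_i e i x *: h i), (x - \sum_i e i x *: h i); split.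
  - by apply/lin_span_rangeP; exists (fun i => e i x).
  - exact: dual_decomposition.
  - by rewrite addrC subrK.
have split_A x : A x -> exists x2 v, [/\ Ahat x2, X1 v & x = x2 + v].
  move=> Ax; have [x2 [v [X2x Kv xE]]] := split_X x; exists x2, v; split=> //.
  split=> // j; have -> : x2 = x - v by rewrite xE addrK.
  by have [_ ] := AD _ _ (common_kernelN Kv) Ax.
(* On a piece, [f x2] is a combination of the [T i (h k)] plus [b i], all in the data set, which the
   maximal chain puts in [set_sum TX1 Z]. *)
have fE x : set_sum TX1 Z (f x).
  have DE := maximal_extension_chain_sub w_max.
  have [x2 [v [X2x Kv ->]]] := split_X x; rewrite fD//.
  apply: linear_subsetD => //; last first.
    by exists (T ord0 v); [exists v | exists 0; [case: linZ | rewrite addr0]].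
  have [i Px] := piece_of x2; rewrite (f_eq _ _ Px); apply: linear_subsetD => //.
    have /lin_span_rangeP[a ->] := X2x; rewrite linear_sum.
    apply: linear_subset_sum => // k; rewrite linearZ; apply: linear_subsetZ => //.
    by apply: DE; exists i => //; left; exists k.
  by apply: DE; exists i => //; right.
have fhatP x : TX1 (f x - fhat x) /\ Z (fhat x).
  rewrite /fhat; have [y Ty [z Zz <-]] := fE x.
  by rewrite /PiZ proj_alongE// addrK.
have fhatD x v : X1 v -> fhat (x + v) = fhat x.
  move=> Kv; have [fx Zx] := fhatP x; rewrite {1}/fhat fD//.
  rewrite -{1}(subrK (fhat x) (f x)) addrAC /PiZ proj_alongE//.
  by apply: linear_subsetD => //; exists v.
have WEA x : A x ->
    WE (f @` A) C (f x) <-> ~ exists2 x', A x' & C° (f x - f x').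
  move=> Ax; split=> [[_ nx] [x' Ax' Cx']|nx].
    by apply: nx; exists (f x') => //; exists x'.
  by split; [exists x | move=> [_ [x' Ax' <-] Cx']; apply: nx; exists x'].
have WEAhat x : Ahat x -> WE_in Z (fhat @` Ahat) CZ (fhat x) <->
    ~ exists2 x', Ahat x' & rel_interior Z CZ (fhat x - fhat x').
  move=> Ax; split=> [[_ nx] [x' Ax' Cx']|nx].
    by apply: nx; exists (fhat x') => //; exists x'.
  by split; [exists x | move=> [_ [x' Ax' <-] Cx']; apply: nx; exists x'].
split=> [E0|EC].
  have WE_A x : A x -> WE (f @` A) C (f x).
    move=> Ax; apply/WEA => // -[x' Ax' Cx'].
    suff : set0 (f x - f x') by [].
    by rewrite -E0; split=> //; apply: linear_subsetB.
  split; apply/seteqP; split.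
  - by move=> y [].
  - by move=> _ [x Ax <-]; exact: WE_A.
  - by move=> x [].
  - by move=> x Ax; split=> //; exact: WE_A.
(* Domination in the reduced problem is domination in the original one after a shift by some [v] in
   [X1], chosen so that [T ord0 v] corrects the component in [TX1]. *)
have domP x x' : rel_interior Z CZ (fhat x - fhat x') <->
    exists2 v, X1 v & C° (f x - f (x' + v)).
  have [fx Zx] := fhatP x; have [fx' Zx'] := fhatP x'.
  rewrite rel_interior_proj_along//; split=> [[_ [y Ty Cy]]|[v Kv Cv]].
    have [v Kv vE] : TX1 ((f x - fhat x) - (f x' - fhat x') - y).
      by apply: linear_subsetB => //; apply: linear_subsetB.
    by exists v => //; rewrite fD// (subr_components vE).
  split; first exact: linear_subsetB.
  exists ((f x - fhat x) - (f x' - fhat x') - T ord0 v).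
    by apply: linear_subsetB => //; [apply: linear_subsetB | exists v].
  by rewrite -(subr_components (esym (subKr _ _))) -fD.
have WEP x v : Ahat x -> X1 v -> WE (f @` A) C (f (x + v)) <->
    WE_in Z (fhat @` Ahat) CZ (fhat x).
  move=> Ax Kv; rewrite WEAhat// WEA; last by apply: AD => //; exact: AhatA.
  (* A dominating point of [Ahat] yields the point [x' + v'] of [A]; conversely a dominating point
     of [A] is split and its part in [X1] serves as the shift in [domP]. *)
  split=> nx [x' Ax'].
    rewrite -(fhatD x v)// domP => -[v' Kv' Cx']; apply: nx.
    by exists (x' + v') => //; apply: AD => //; exact: AhatA.
  have [x2 [v' [Ax2 Kv' ->]]] := split_A _ Ax' => Cx'; apply: nx; exists x2 => //.
  by rewrite -(fhatD x v)// domP; exists v'.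
split; apply/seteqP; split.
- move=> y [[x Ax <-]]; have [x2 [v [Ax2 Kv ->]]] := split_A _ Ax => nx.
  have WEx : WE_in Z (fhat @` Ahat) CZ (fhat x2).
    apply/(WEP _ v) => //; split => //; exists (x2 + v) => //.
    by apply: AD => //; exact: AhatA.
  exists (f (x2 + v) - fhat x2); last by exists (fhat x2) => //; rewrite subrK.
  by rewrite -(fhatD x2 v)//; case: (fhatP (x2 + v)).
- move=> _ [y Ty [_ [[x Ax <-] nx] <-]].
  (* The shift [v] moves the [TX1]-component of [f x] to the prescribed [y]. *)
  have [v Kv vE] : TX1 (y - (f x - fhat x)).
    by apply: linear_subsetB => //; case: (fhatP x).
  have -> : y + fhat x = f (x + v).
    by rewrite fD// vE opprB addrCA [f x + _]addrC subrK.
  by apply/WEP => //; split=> //; exists x.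
- move=> x [Ax]; have [x2 [v [Ax2 Kv ->]]] := split_A _ Ax.
  by move=> /(WEP _ _ Ax2 Kv) nx; exists v => //; exists x2; rewrite // addrC.
- move=> _ [v Kv [x [Ax nx] <-]]; rewrite addrC; split; last exact/WEP.
  by apply: AD => //; exact: AhatA.
Qed.
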